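(* For any real $0<\alpha<1$ there exists an integer $N_\alpha$ such that for every prime power $q$, every $n\geq N_\alpha$, every $[n,k]_q$ code $\mathcal{C}$ with rate $\frac{k}{n}\leq\alpha$, and all integers $t$ with $1\leq t\leq\min\{k,n-k\}$, \[ \delta_t(\mathcal{C})\leq R_t(\mathcal{C}).\]
   Context: An $[n,k]_q$ code $\mathcal{C}$ is a $k$-dimensional $\mathbb{F}_q$-linear subspace of $\mathbb{F}_q^n$. For a matrix $V\in\mathbb{F}_q^{t\times n}$, $\operatorname{wt}(V)$ is the number of non-zero columns of $V$, and $d(V,V')=\operatorname{wt}(V-V')$. For an integer $t\geq 1$, $\mathcal{C}^t$ is the set of matrices in $\mathbb{F}_q^{t\times n}$ all of whose rows are in $\mathcal{C}$. For $1\leq t\leq k$, the $t$-th generalized Hamming weight is $d_t(\mathcal{C})=\min\{\operatorname{wt}(C): C\in\mathcal{C}^t,\ \operatorname{rank} C=t\}$, and $\delta_t(\mathcal{C})=\lfloor (d_t(\mathcal{C})-1)/2\rfloor$. The $t$-th generalized covering radius is $R_t(\mathcal{C})=\max_{V\in\mathbb{F}_q^{t\times n}}\min_{C\in\mathcal{C}^t} d(V,C)$. *)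

(* Defs.v *)
From HB Require Import structures.
From mathcomp Require Import all_boot all_order all_algebra.
From mathcomp Require Import reals.

Set Implicit Arguments.
Unset Strict Implicit.
Unset Printing Implicit Defensive.

Import GRing.Theory.

Section GeneralizedWeights.
Variables (F : finFieldType) (n : nat).
Implicit Types (C : {vspace 'rV[F]_n}) (t : nat).

Definition wt t (V : 'M[F]_(t, n)) : nat := #|[set j | col j V != 0%R]|.

Definition mxdist t (V W : 'M[F]_(t, n)) : nat := wt (V - W)%R.

Definition code_pow C t : {set 'M[F]_(t, n)} :=
  [set V | [forall i, row i V \in C]].

(* In both minima below, the default value n is neutral because wt V <= n
   for every V, so each is the minimum whenever its index set is nonempty:
   for gen_weight when t <= \dim C, for gen_covering_radius always (the zero
   matrix is in code_pow C t). *)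
Definition gen_weight C t : nat :=
  \big[minn/n]_(V in code_pow C t | \rank V == t) wt V.

Definition gen_packing_radius C t : nat := (gen_weight C t - 1) %/ 2.

Definition gen_covering_radius C t : nat :=
  \max_(V : 'M[F]_(t, n)) \big[minn/n]_(W in code_pow C t) mxdist V W.

End GeneralizedWeights.

(* Main.v *)
Require Import Defs.
From HB Require Import structures.
From mathcomp Require Import all_boot all_order all_algebra.
From mathcomp Require Import reals.
From mathcomp Require Import zify ring lra.
Set Implicit Arguments.
Unset Strict Implicit.
Unset Printing Implicit Defensive.
Import GRing.Theory.
Import Order.TTheory Num.Theory.

(* Put [q = #|F|], [r = n - k], [Q = q^t], and suppose that [rho = R_t < delta_t], so that
   [d_t >= 2 rho + 3]. Covering the [t x n] matrices by balls of radius [rho] gives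
   (1) [Q^r <= sum_(i <= rho) 'C(n, i) (Q - 1)^i]. As [n = O(r)] and [d_t <= r + t] (Singleton),
   (1) forces [q^t] or [q^(r - t)] to be bounded in terms of [alpha].

   If [q^t] is bounded (and [t > 1]; for [t = 1] balls of radius [rho + 1] are disjoint), then
   [t + 1] vectors of weight [e] in general position in one coset of the code differ by a subcode
   of dimension [t] with at most [(t + 1) e] support coordinates, whence
   ['C(n, e) (q - 1)^e <= q^(r + t - 1)] for [e = (2 rho + 2) / (t + 1)]. With [w = e / (n - e)],
   bounding the volume in (1) by its generating function at a multiple of [w], and ['C(n, e)]
   from below as the largest term of [(e + (n - e))^n], the two bounds differ by the factor
   [((1 + w)^(t + 1) / (1 + (t + 1) w / 2)^2)^n], which is exponentially large.

   If [q^(r - t)] is bounded, let [c = r + t - 2 rho - 2 > 0]. Since [d_t > r + t - c], few rows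
   of the redundancy part of a systematic generator matrix can lie in a common subspace of
   codimension [c], so that [k] is at most about [Y t] with [Y = q^c]. Then (1) fails because
   [(1 + 1 / Y)^(Y + 1) <= 27 / 8 < 4 <= q^2]. *)

(** * Volume estimates *)

(** Since [a <= b], replacing [a ^ rho * b ^ (n - rho)] by [a ^ i * b ^ (n - i)] only increases the
    terms with [i <= rho], and these become terms of the binomial expansion on the right. *)
Lemma volume_leq (n rho s a b : nat) : rho <= n -> a <= b ->
  (\sum_(i < rho.+1) 'C(n, i) * s ^ i) * (a ^ rho * b ^ (n - rho)) <= (b + s * a) ^ n.
Proof.
move=> rn ab; rewrite expnDn big_distrl /=.
rewrite [leqRHS](bigID (fun i : 'I_n.+1 => i < rho.+1)) /=.
apply: leq_trans (leq_addr _ _).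
rewrite (big_ord_widen n.+1 (fun i => 'C(n, i) * s ^ i * (a ^ rho * b ^ (n - rho)))) //.
apply: leq_sum => i; rewrite ltnS => ir.
rewrite -mulnA leq_mul2l expnMn; apply/orP; right.
have ab' : a ^ (rho - i) <= b ^ (rho - i).
  by case: (posnP (rho - i)) => [->//|d0]; rewrite leq_exp2r.
have {}ab' := leq_mul (leqnn (a ^ i * s ^ i * b ^ (n - rho))) ab'.
rewrite -{1}(subnKC ir) -(subnK (leq_sub2l n ir)) (_ : n - i - (n - rho) = rho - i); last lia.
by rewrite !expnD; lia.
Qed.

(** The terms [T i] of the expansion of [((n - e) + e) ^ n] satisfy T(i+1)/T(i) = (n-i)e /
    ((i+1)(n-e)), so they grow up to [i = e] and decrease from there on. *)
Lemma bin_max_term (n e : nat) : e <= n ->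
  n ^ n <= n.+1 * ('C(n, e) * (e ^ e * (n - e) ^ (n - e))).
Proof.
move=> en; case: (ltngtP e n) en => // [en _|-> _]; last first.
  by rewrite subnn binn; lia.
pose T i := 'C(n, i) * ((n - e) ^ (n - i) * e ^ i).
have b_gt0 : 0 < n - e by lia.
have step i : i < n -> i.+1 * (n - e) * T i.+1 = (n - i) * e * T i.
  move=> ni; rewrite /T.
  have := mul_bin_left n i; rewrite (_ : n - i = (n - i.+1).+1); last by lia.
  rewrite !expnS => h; have := congr1 (muln ((n - e) * (n - e) ^ (n - i.+1) * (e * e ^ i))) h.
  lia.
have up i j : i <= j <= e -> T i <= T j.
  elim: j => [|j IHj] /andP[]; first by rewrite leqn0 => /eqP ->.
  rewrite leq_eqVlt => /predU1P[->//|]; rewrite ltnS => ij je.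
  apply: leq_trans (IHj _) _; first by lia.
  have := step j ltac:(lia); have : j.+1 * (n - e) <= (n - j) * e by nia.
  have : 0 < j.+1 * (n - e) by rewrite muln_gt0.
  move: (j.+1 * _) ((n - j) * _) => x y; nia.
have down i j : e <= i <= j -> j <= n -> T j <= T i.
  elim: j => [|j IHj] /andP[ei]; first by rewrite leqn0 => /eqP ->.
  rewrite leq_eqVlt => /predU1P[->//|]; rewrite ltnS => ij jn.
  apply: leq_trans _ (IHj _ _); [|lia|lia].
  have := step j ltac:(lia); have : (n - j) * e <= j.+1 * (n - e) by nia.
  have : 0 < j.+1 * (n - e) by rewrite muln_gt0.
  move: (j.+1 * _) ((n - j) * _) => x y; nia.
apply: (@leq_trans (\sum_(i < n.+1) T e)); last first.
  by rewrite sum_nat_const card_ord /T [e ^ e * _]mulnC.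
rewrite -{1}(subnK (ltnW en)) expnDn; apply: leq_sum => i _.
rewrite -[leqLHS]/(T i).
have := ltn_ord i; rewrite ltnS => ni; case: (leqP i e) => ie; first by apply: up; lia.
by apply: down; lia.
Qed.

(** The sequence (1 + 1/Y)^(Y+1) decreases, and equals 27/8 at [Y = 2]. The decrease is Bernoulli's
    inequality for the base 1 + 1/(Y(Y+2)), because Y(Y+2) + 1 = (Y+1)^2. *)
Lemma leq_expS_ratio (Y : nat) : 2 <= Y -> 8 * Y.+1 ^ Y.+1 <= 27 * Y ^ Y.+1.
Proof.
elim: Y => // Y IHY; rewrite ltnS leq_eqVlt => /predU1P[<- //|Y1].
have {IHY} IH := IHY Y1.
have bern (x m : nat) : x ^ m.+1 + m.+1 * x ^ m <= x.+1 ^ m.+1.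
  elim: m => [|m IHm]; first by lia.
  rewrite [leqRHS]expnS; apply: leq_trans (leq_mul (leqnn x.+1) IHm).
  by rewrite [x ^ m.+2]expnS ![x ^ m.+1]expnS; nia.
have := bern (Y * Y.+2) Y; have -> : (Y * Y.+2).+1 = Y.+1 * Y.+1 by lia.
rewrite !expnMn => h.
have dec : Y.+2 ^ Y.+2 * Y ^ Y.+1 <= Y.+1 ^ Y.+1 * Y.+1 ^ Y.+2.
  rewrite [Y.+1 ^ Y.+2]expnS mulnCA.
  apply: leq_trans (leq_mul (leqnn Y.+1) h).
  rewrite ![_ ^ Y.+2]expnS ![_ ^ Y.+1]expnS; move: (Y ^ Y) (Y.+2 ^ Y) => u v.
  have := leq_mul (leqnn (u * v)) (_ : Y * Y.+2 * Y.+2 <= Y.+1 * (Y * Y.+2 + Y.+1)).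
  by move=> /(_ ltac:(nia)); nia.
rewrite -(@leq_pmul2r (Y ^ Y.+1)); last by rewrite expn_gt0; case: (Y) Y1.
by move: IH dec; nia.
Qed.

Section VolumeBounds.
Variables (n rho r Q : nat).
Hypotheses (rho_n : rho <= n) (rho_r : rho <= r) (Q_gt0 : 0 < Q).
Hypothesis vol : Q ^ r <= \sum_(i < rho.+1) 'C(n, i) * (Q - 1) ^ i.

(** This is [volume_leq] at [a = 1], [b = Q * Y], where [b + (Q - 1) * a <= Q * Y.+1]; the powers of
    [Q] then cancel except for [r - rho] of them. *)
Lemma volume_exp (Y : nat) : 0 < Y -> Q ^ (r - rho) * Y ^ n <= Y.+1 ^ n * Y ^ rho.
Proof.
move=> Y_gt0; have QY : 1 <= Q * Y by rewrite muln_gt0 Q_gt0.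
have := volume_leq (Q - 1) rho_n QY; rewrite exp1n mul1n muln1 => h.
have {}h := leq_trans (leq_mul vol (leqnn ((Q * Y) ^ (n - rho)))) h.
have le : (Q * Y + (Q - 1)) ^ n <= Q ^ n * Y.+1 ^ n.
  rewrite -expnMn; case: (posnP n) => [->//|n_gt0]; rewrite leq_exp2r //; nia.
have {le} := leq_trans h le.
rewrite -{1}(subnK rho_r) -{2}(subnK rho_n) !expnD !expnMn.
rewrite -{5}(subnK rho_n) expnD => {}h.
have := @leq_pmul2l (Q ^ (n - rho) * Q ^ rho); rewrite muln_gt0 !expn_gt0 Q_gt0 => /(_ _ _ isT) <-.
have := leq_mul h (leqnn (Y ^ rho)); lia.
Qed.

(** The fourth power of [volume_exp] at [Y = 1], with 4(r - rho) >= 2(r - t + 3), bounds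
    q^(2t(r-t+3)) by 16^(Ar). One of [2 * t] and 2(r - t + 3) is at least [r], and an [r]-th root
    bounds the other factor. *)
Lemma volume_dichotomy (q t A : nat) : 0 < q -> Q = q ^ t -> 0 < r -> n <= A * r ->
  t <= r -> 2 * rho + 3 <= r + t -> q ^ t <= 16 ^ A \/ q ^ (r - t + 3) <= 16 ^ A.
Proof.
move=> q_gt0 Qq r_gt0 nA tr rt.
have h : (q ^ t) ^ (4 * (r - rho)) <= 16 ^ (A * r).
  have := @volume_exp 1 isT; rewrite !exp1n !muln1 => h; rewrite -Qq mulnC expnM.
  apply: (@leq_trans ((2 ^ n) ^ 4)); first by rewrite leq_exp2r.
  by rewrite -expnM mulnC expnM leq_pexp2l.
have [tr2|rt2] := leqP (2 * t) r; [left | right].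
  rewrite -(@leq_exp2r _ _ r) // -[leqRHS]expnM; apply: leq_trans h.
  by rewrite leq_pexp2l ?expn_gt0 ?q_gt0 //; lia.
rewrite -(@leq_exp2r _ _ r) // -[leqRHS]expnM; apply: leq_trans h.
by rewrite -!expnM leq_pexp2l //; nia.
Qed.

End VolumeBounds.

(** The pair [c], [l] is meant for [defect_bound]: its conclusion, with [d >= 2 * rho + 3], is
    incompatible with the third inequality. *)
Lemma covering_contradicts_defect (A K : nat) : exists N : nat, forall q t n r k rho : nat,
  N <= n -> n <= A * r -> n = r + k -> 1 < q -> t <= r -> t <= rho ->
  2 * rho + 3 <= r + t -> q ^ (r - t + 3) <= K ->
  (q ^ t) ^ r <= \sum_(i < rho.+1) 'C(n, i) * (q ^ t - 1) ^ i ->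
  exists c l : nat, [/\ 0 < c, c + l <= r, r + t < 2 * rho + 3 + c &
    (t + l) * q ^ (c + l) + k * q ^ c < k * q ^ l + q ^ (c + l)].
Proof.
(* [M] absorbs the factors whose exponents do not grow with [r], see [const]; the contradiction will
   be [2 ^ r <= M]. *)
have [M ME] : exists M, M = 2 ^ (16 * K * K) * K ^ (15 * K) by eexists.
exists (A * (M + 2 * K + 4)).+1 => q t n r k rho Nn nA nrk q1 tr trho rhot qK vol.
have r_big : M + 2 * K + 4 <= r.
  have [A0|A0] := posnP A; first by rewrite A0 in nA Nn; lia.
  by rewrite -(leq_pmul2l A0); apply: leq_trans (ltnW Nn) nA.
pose c := r + t - 2 * rho - 2; pose s := r - t.
have sK : s + 3 < K by apply: leq_trans qK; apply: ltn_expl.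
have r0 : 0 < r by lia.
have rr : rho <= r by lia.
have rn : rho <= n by lia.
have cs : c + 2 <= s by rewrite /c /s; lia.
(* That is, (27/8)^16 <= 2^29, to be compared with (q^2)^15 >= 2^30; the surplus is the final factor
   [2 ^ r]. *)
have three : 3 ^ (48 * r) <= 2 ^ (77 * r).
  rewrite (_ : 48 * r = 5 * (9 * r) + 3 * r); last by lia.
  rewrite (_ : 77 * r = 8 * (9 * r) + 5 * r); last by lia.
  rewrite (expnD 3 (5 * _)) (expnD 2 (8 * _)) (expnM 3 5) (expnM 2 8) (expnM 3 3) (expnM 2 5).
  by apply: leq_mul; rewrite leq_exp2r // muln_gt0.
(* For [l = c + 4] the negation of the last inequality yields [15 k <= 16 Y (t + c + 3)];
   15th powers of [volume_exp] clear the denominator. *)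
exists c, (c + 4); split; [by rewrite /c; lia | by lia | by rewrite /c; lia|].
rewrite ltnNge; apply/negP => small.
set Y := q ^ c in small.
have Y2 : 2 <= Y.
  apply: (@leq_trans (q ^ 1)); first by rewrite expn1.
  by rewrite leq_pexp2l ?(ltnW q1) // /c; lia.
have YK : Y <= K by apply: leq_trans qK; rewrite leq_pexp2l //; lia.
(* Completing [t] to [r = t + s] costs only a bounded factor. Of the result, [Y ^ (15 * r)] cancels
   against the right side of [main], and [q ^ (30 * r)] is the gain. *)
have qr : q ^ (15 * (t * (c + 2))) * q ^ (15 * (s * (c + 2))) = Y ^ (15 * r) * q ^ (30 * r).
  have tsr : t + s = r by rewrite subnKC.
  by rewrite -expnM -!expnD -tsr; congr expn; clear; lia.
have q30 : 2 ^ (30 * r) <= q ^ (30 * r) by rewrite leq_exp2r // muln_gt0.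
have const : 2 ^ (16 * Y * (c + 3)) * q ^ (15 * (s * (c + 2))) <= M.
  rewrite ME; apply: leq_mul.
    by rewrite leq_pexp2l // leq_mul ?leq_mul2l //; clear -cs sK; lia.
  apply: (@leq_trans ((q ^ (s + 3)) ^ (15 * (c + 2)))).
    by rewrite -expnM leq_pexp2l ?(ltnW q1) // [leqRHS]mulnCA leq_mul2l leq_mul2r leq_addr orbT.
  apply: (@leq_trans (K ^ (15 * (c + 2)))); first by rewrite leq_exp2r // muln_gt0 addn2.
  by rewrite leq_pexp2l ?leq_mul2l //; clear -cs sK; lia.
have k_small : 15 * k <= 16 * Y * (t + c + 3).
  have q4 : 16 <= q ^ 4 by rewrite (_ : 16 = 2 ^ 4) // leq_exp2r.
  move: small; rewrite !expnD -/Y.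
  move: (q ^ 4) q4 => q4 q4_ge h.
  have {}h : k * q4 <= (t + c + 3) * (Y * q4) + k.
    have : Y * (k * q4) <= Y * ((t + c + 3) * (Y * q4) + k) by nia.
    by rewrite leq_pmul2l //; lia.
  rewrite -mulnA [Y * _]mulnC; move: h; rewrite mulnA; move: (_ * Y) => W h.
  rewrite leqNgt; apply/negP => kW.
  have h1 := leq_mul (leqnn k) q4_ge.
  by have h2 := leq_mul kW (leqnn q4); lia.
(* By [k_small] and [t <= r], [m] is at least [15 * n]. Its first summand is a multiple of [Y.+1],
   so that the [16 * r]-th power of [leq_expS_ratio] applies to it. *)
pose m := 16 * Y.+1 * r + 16 * Y * (c + 3).
have nm : 15 * n <= m by have h := leq_mul (leqnn Y) tr; rewrite nrk /m; clear -k_small h; lia.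
have main : q ^ (15 * (t * (c + 2))) * Y ^ m <= Y.+1 ^ m * Y ^ (15 * r).
  have := volume_exp rn rr (_ : 0 < q ^ t) vol (_ : 0 < Y).
  rewrite expn_gt0 (ltnW q1) => /(_ isT (ltnW Y2)) h.
  have {}h : q ^ (t * (c + 2)) * Y ^ n <= Y.+1 ^ n * Y ^ r.
    apply: leq_trans (leq_trans _ h) _.
      rewrite leq_mul2r expnM leq_pexp2l ?orbT ?expn_gt0 ?(ltnW q1) //.
      by clear -cs rhot trho; rewrite /c; lia.
    by rewrite leq_mul2l leq_pexp2l ?orbT // (ltnW Y2).
  rewrite -(subnKC nm) (expnD Y (15 * n)) (expnD Y.+1 (15 * n)).
  have {}h : q ^ (15 * (t * (c + 2))) * Y ^ (15 * n) <= Y.+1 ^ (15 * n) * Y ^ (15 * r).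
    by move: h; rewrite -(@leq_exp2r _ _ 15) // !expnMn -!expnM ![_ * 15]mulnC.
  have h2 : Y ^ (m - 15 * n) <= Y.+1 ^ (m - 15 * n).
    by case: (posnP (m - 15 * n)) => [->//|m0]; rewrite leq_exp2r.
  by rewrite [leqLHS]mulnA [leqRHS]mulnAC leq_mul.
have euler : 2 ^ (48 * r) * Y.+1 ^ (16 * Y.+1 * r) <= 3 ^ (48 * r) * Y ^ (16 * Y.+1 * r).
  have := leq_expS_ratio Y2; rewrite -(@leq_exp2r _ _ (16 * r)); last by rewrite muln_gt0.
  rewrite (expnMn 8) (expnMn 27) -(expnM Y.+1) -(expnM Y).
  have -> : 48 * r = 3 * (16 * r) by lia.
  rewrite (expnM 2) (expnM 3) (_ : Y.+1 * (16 * r) = 16 * Y.+1 * r) //; clear; lia.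
have half : Y.+1 ^ (16 * Y * (c + 3)) <= 2 ^ (16 * Y * (c + 3)) * Y ^ (16 * Y * (c + 3)).
  rewrite -expnMn; case: (posnP (16 * Y * (c + 3))) => [->//|m0]; rewrite leq_exp2r //; clear -Y2; lia.
have fin : 2 ^ (48 * r) * q ^ (15 * (t * (c + 2))) <=
    2 ^ (77 * r) * 2 ^ (16 * Y * (c + 3)) * Y ^ (15 * r).
  have Ym : 0 < Y ^ m by rewrite expn_gt0 (ltnW Y2).
  rewrite -(leq_pmul2r Ym) -mulnA; apply: leq_trans (leq_mul (leqnn _) main) _.
  rewrite /m (expnD Y (16 * Y.+1 * r)) (expnD Y.+1 (16 * Y.+1 * r)).
  have := leq_mul (leq_mul euler half) (leqnn (Y ^ (15 * r))).
  have := leq_mul three (leqnn (Y ^ (16 * Y.+1 * r) *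
    (2 ^ (16 * Y * (c + 3)) * Y ^ (16 * Y * (c + 3))) * Y ^ (15 * r))).
  move: (2 ^ (48 * r)) (3 ^ _) (2 ^ (77 * r)) (Y ^ (15 * r)) (2 ^ (16 * Y * (c + 3))).
  move: (Y ^ (16 * Y.+1 * r)) (Y ^ (16 * Y * (c + 3))).
  move: (Y.+1 ^ (16 * Y.+1 * r)) (Y.+1 ^ (16 * Y * (c + 3))).
  by clear=> a1 a2 a3 a4 a5 a6 a7 a8 a9 h1 h2; lia.
have last : 2 ^ r <= M.
  have Yr : 0 < Y ^ (15 * r) by rewrite expn_gt0 (ltnW Y2).
  have two : 0 < 2 ^ (77 * r) by rewrite expn_gt0.
  have e78 : 2 ^ (48 * r) * 2 ^ (30 * r) = 2 ^ (77 * r) * 2 ^ r.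
    by rewrite -!expnD; congr expn; clear; lia.
  have := leq_mul fin (leqnn (q ^ (15 * (s * (c + 2))))).
  rewrite -[X in X <= _ -> _]mulnA qr => {}fin.
  rewrite -(leq_pmul2l two) -e78.
  rewrite -(leq_pmul2r Yr).
  have := leq_mul (leqnn (2 ^ (77 * r) * Y ^ (15 * r))) const.
  have := leq_mul (leqnn (2 ^ (48 * r) * Y ^ (15 * r))) q30.
  move: fin; move: (2 ^ (48 * r)) (2 ^ (30 * r)) (q ^ (30 * r)) (Y ^ (15 * r)).
  move: (2 ^ (77 * r)) (2 ^ (16 * Y * (c + 3))) (q ^ (15 * (s * (c + 2)))).
  by clear=> a1 a2 a3 a4 a5 a6 a7 h1 h2 h3; lia.
have := leq_trans (ltn_expl r (isT : 1 < 2)) last; rewrite ltnNge => /negP; apply.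
by clear -r_big; lia.
Qed.

(** * Elementary inequalities over the reals *)

Local Open Scope ring_scope.

Lemma bernoulli (R : realFieldType) (x : R) (m : nat) : 0 <= x -> 1 + m%:R * x <= (1 + x) ^+ m.
Proof.
move=> x0; elim: m => [|m IHm]; first by rewrite mul0r addr0.
rewrite exprS -natr1; apply: le_trans (ler_wpM2l _ IHm); last by rewrite addr_ge0.
have : 0 <= m%:R * (x * x) by rewrite !mulr_ge0.
nra.
Qed.

Lemma bernoulli2 (R : realFieldType) (x : R) (m : nat) : 0 <= x ->
  1 + m.+1%:R * x + m.+1%:R * m%:R / 2 * x ^+ 2 <= (1 + x) ^+ m.+1.
Proof.
move=> x0; elim: m => [|m IHm]; first by rewrite expr1; lra.
rewrite exprS; apply: le_trans (ler_wpM2l _ IHm); last by rewrite addr_ge0.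
have : 0 <= m.+1%:R * m%:R * x ^+ 3 :> R by rewrite !mulr_ge0 ?exprn_ge0.
rewrite -[m.+2%:R]natr1 -[m.+1%:R]natr1; move: (m%:R) => M h.
rewrite -subr_ge0; apply: le_trans (_ : 0 <= (M + 1) * M * x ^+ 3 / 2) _; first by rewrite divr_ge0.
by rewrite le_eqVlt; apply/orP; left; apply/eqP; field.
Qed.

Lemma exprD1_leq2 (R : realFieldType) (x : R) (m : nat) : 0 <= x -> 2 * m%:R * x <= 1 ->
  (1 + x) ^+ m <= 2.
Proof.
move=> x0 mx; suff h : (1 + x) ^+ m <= 1 + 2 * m%:R * x by apply: le_trans h _; lra.
elim: m mx => [|m IHm] mx; first by rewrite expr0; lra.
have mx' : 2 * m%:R * x <= 1 by move: mx; rewrite -natr1; nra.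
rewrite exprS; apply: le_trans (ler_wpM2l _ (IHm mx')) _; first by rewrite addr_ge0.
have h : 0 <= x * (1 - 2 * m%:R * x) by rewrite mulr_ge0 // subr_ge0.
by rewrite -[m.+1%:R]natr1; nra.
Qed.

(** Split the exponent into [D.+1] blocks of length [j], each contributing at least [j * x] and
    hence [n.+1 * y]. This gives [D.+1] factors [n.+1], and the one left over beats M / y^(D+1). *)
Lemma exp_dominates_poly (R : archiRealFieldType) (x : R) (D M : nat) : 0 < x ->
  exists N : nat, forall n : nat, (N <= n)%N -> (M * n.+1 ^ D)%:R < (1 + x) ^+ n.
Proof.
move=> x0; pose y := x / (2 * D.+1%:R); have y0 : 0 < y by rewrite divr_gt0 ?mulr_gt0.
pose B := Num.bound (M%:R / y ^+ D.+1).
have hB : M%:R / y ^+ D.+1 < B%:R.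
  by apply: archi_boundP; rewrite divr_ge0 // exprn_ge0 // ltW.
exists (B + 2 * D.+1)%N => n nN; pose j := (n %/ D.+1)%N.
have jn : (j * D.+1 <= n)%N := leq_trunc_div _ _.
have nj : (n.+1 <= 2 * (D.+1 * j))%N.
  by have := divn_eq n D.+1; have := ltn_pmod n (ltn0Sn D); rewrite -/j; nia.
have le1 : (1 + x) ^+ (j * D.+1) <= (1 + x) ^+ n by apply: ler_weXn2l => //; lra.
apply: lt_le_trans le1; rewrite exprM.
have le2 : (n.+1%:R * y) ^+ D.+1 <= ((1 + x) ^+ j) ^+ D.+1.
  apply: lerXn2r; rewrite ?nnegrE.
  - by rewrite mulr_ge0 // ltW.
  - by rewrite exprn_ge0 // addr_ge0 // ltW.
  apply: le_trans (bernoulli j (ltW x0)); apply: le_trans (_ : j%:R * x <= _); last by lra.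
  rewrite /y mulrA ler_pdivrMr ?mulr_gt0 // mulrAC; rewrite ler_wpM2r ?(ltW x0) //.
  by rewrite -!natrM ler_nat; lia.
apply: lt_le_trans le2; rewrite exprMn natrM [n.+1%:R ^+ _]exprS.
rewrite mulrAC -natrX ltr_pM2r ?ltr0n ?expn_gt0 // -ltr_pdivrMr ?exprn_gt0 //.
by apply: lt_le_trans hB _; rewrite ler_nat; lia.
Qed.

(** Divided by [q - 1], it bounds 1 + q + ... + q^m by (m+2)/2 times its last term; at [m = t.-1]
    the constant is the (t+1)/2 occurring in [v] and [b]. *)
Lemma geometric_leq (q m : nat) : (1 < q)%N ->
  (2 * (q ^ m.+1 - 1) <= m.+2 * (q - 1) * q ^ m)%N.
Proof.
move=> q1; elim: m => [|m IHm]; first by rewrite expn1 muln1.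
have Q1 : (1 < q ^ m.+1)%N by rewrite -[1%N](expn0 q) ltn_exp2l.
have {}IHm := leq_mul (leqnn q) IHm.
have h : (2 * (q - 1) <= (q - 1) * q ^ m.+1)%N by rewrite mulnC leq_mul2l Q1 orbT.
move: IHm h Q1; rewrite !expnS; move: (q ^ m)%N => P.
nia.
Qed.

(** The four inequalities are used with [V] the n-th power of 1 + v, [P] the gain of [slack] over n
    coordinates, and [p = t.+1]. Chaining them eliminates [V], [s], [b] and [y]. *)
Lemma covering_packing_combine (R : realFieldType) (X s V y b P c N z : R) (rho e p t : nat) :
  0 < b -> 0 < y -> 0 <= s -> 0 <= P -> 0 <= c -> 0 <= z ->
  (X * (b * y) ^+ rho) ^+ 2 <= (s ^+ rho * V) ^+ 2 ->
  V ^+ 2 * P <= (c * y ^+ e) ^+ p ->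
  y ^+ (p * e) <= N ^+ t * y ^+ (2 * rho) ->
  s ^+ (2 * rho) <= b ^+ (2 * rho) * z ^+ (2 * rho) ->
  X ^+ 2 * P <= z ^+ (2 * rho) * c ^+ p * N ^+ t.
Proof.
move=> b0 y0 s0 P0 c0 z0 H1 H2 H3 H4.
have d0 : 0 < b ^+ (2 * rho) * y ^+ (2 * rho) by rewrite mulr_gt0 // exprn_gt0.
rewrite -(ler_pM2r d0).
have -> : X ^+ 2 * P * (b ^+ (2 * rho) * y ^+ (2 * rho)) = (X * (b * y) ^+ rho) ^+ 2 * P.
  by rewrite !exprMn -!exprM [(rho * 2)%N]mulnC mulrAC.
apply: le_trans (ler_wpM2r P0 H1) _.
have -> : (s ^+ rho * V) ^+ 2 * P = s ^+ (2 * rho) * (V ^+ 2 * P).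
  by rewrite exprMn -exprM [(rho * 2)%N]mulnC mulrA.
apply: le_trans (ler_wpM2l _ H2) _; first by rewrite exprn_ge0.
apply: le_trans (ler_wpM2r _ H4) _; first by rewrite exprn_ge0 // mulr_ge0 // exprn_ge0 // ltW.
have -> : (c * y ^+ e) ^+ p = c ^+ p * y ^+ (p * e) by rewrite exprMn -exprM [(e * p)%N]mulnC.
rewrite mulrA; apply: le_trans (ler_wpM2l _ H3) _.
  by rewrite mulr_ge0 ?mulr_ge0 ?exprn_ge0 // ltW.
by rewrite le_eqVlt; apply/orP; left; apply/eqP; ring.
Qed.

(** * Comparison of the covering and packing bounds *)

Section CoveringPacking.
Variables (R : realFieldType) (q t n r rho e : nat).
Hypotheses (q_gt1 : (1 < q)%N) (t_gt1 : (1 < t)%N) (e_gt0 : (0 < e)%N) (en : (e < n)%N).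
Hypothesis small_e : (t.+1 * e <= 2 * (n - e))%N.
Hypothesis rho_e : (2 * rho <= t.+1 * e + t)%N.
Hypothesis rho_n : (rho <= n)%N.
Hypothesis vol : ((q ^ t) ^ r <= \sum_(i < rho.+1) 'C(n, i) * (q ^ t - 1) ^ i)%N.
Hypothesis pack : ('C(n, e) * (q - 1) ^ e <= q ^ (r + t.-1))%N.

(* The generating function of the ball volumes is evaluated at [v / (q ^ t - 1)]. *)
Let w : R := e%:R / (n - e)%:R.
Let v : R := t.+1%:R / 2 * w.
Let y : R := w / (q - 1)%:R.
Let b : R := t.+1%:R / 2 * (q - 1)%:R.

Let ne_gt0 : 0 < (n - e)%:R :> R. Proof. by rewrite ltr0n subn_gt0. Qed.
Let q1_gt0 : 0 < (q - 1)%:R :> R. Proof. by rewrite ltr0n subn_gt0. Qed.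
Let w_gt0 : 0 < w. Proof. by rewrite divr_gt0 // ltr0n. Qed.
Let y_gt0 : 0 < y. Proof. exact: divr_gt0. Qed.
Let v_gt0 : 0 < v. Proof. by rewrite mulr_gt0 // divr_gt0. Qed.
Let b_gt0 : 0 < b. Proof. by rewrite mulr_gt0 // divr_gt0. Qed.

Let v_le1 : v <= 1.
Proof.
rewrite /v /w mulrA ler_pdivrMr // mul1r mulrAC ler_pdivrMr // -!natrM ler_nat.
by rewrite mulnC [leqRHS]mulnC mulnC.
Qed.

Let y_le1 : y <= 1.
Proof.
rewrite ler_pdivrMr // mul1r ler_pdivrMr // -natrM ler_nat.
nia.
Qed.

(** It pays for the rounding in [e]: [2 * rho] may exceed [t.+1 * e] by up to [t], and each missing
    factor [y] costs at most [n * q]. *)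
Let y_ge : 1 <= (n * q)%:R * y.
Proof.
rewrite /y /w mulrA ler_pdivlMr // mul1r mulrA ler_pdivlMr // -!natrM ler_nat.
nia.
Qed.

Let covering : ((q ^ t) ^ r)%:R * v ^+ rho <= (q ^ t - 1)%:R ^+ rho * (1 + v) ^+ n.
Proof.
have Q_gt0 : (0 < q ^ t - 1)%N.
  by rewrite subn_gt0 (@leq_trans (q ^ 1)) ?leq_pexp2l ?(ltnW q_gt1) ?(ltnW t_gt1).
(* The two sides are integers with quotient [v / (q ^ t - 1)], the evaluation point. *)
have ab : (t.+1 * e <= 2 * (n - e) * (q ^ t - 1))%N.
  by apply: leq_trans small_e _; rewrite leq_pmulr.
have := volume_leq (q ^ t - 1) rho_n ab.
move/(leq_trans (leq_mul vol (leqnn _))).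
rewrite [(2 * (n - e) * _)%N]mulnC -mulnDr (expnMn _ _ n) (expnMn (q ^ t - 1)).
rewrite -(ler_nat R) !natrM !natrX natrD !natrM.
set x := (n - e)%:R; set s := (q ^ t - 1)%:R.
have s_gt0 : 0 < s by rewrite ltr0n.
have x_gt0 : 0 < 2 * x by rewrite mulr_gt0.
have -> : t.+1%:R * e%:R = v * (2 * x).
  by rewrite /v /w -/x; field; rewrite lt0r_neq0.
rewrite -[X in X + v * _]mul1r -mulrDl; move: (2 * x) x_gt0 => z z_gt0.
rewrite [(v * z) ^+ rho]exprMn [((1 + v) * z) ^+ n]exprMn.
rewrite -[in s ^+ n](subnKC rho_n) -[in z ^+ n](subnKC rho_n) (exprD s) (exprD z) => h.
have c0 : 0 < z ^+ rho * (z ^+ (n - rho) * s ^+ (n - rho)).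
  by rewrite !mulr_gt0 ?exprn_gt0.
rewrite -(ler_pM2r c0); apply: le_trans (le_trans _ h) _.
  by rewrite le_eqVlt; apply/orP; left; apply/eqP; ring.
by rewrite le_eqVlt; apply/orP; left; apply/eqP; ring.
Qed.

(** To second order, the right side exceeds (1+v)^2 by (t^2-1)/4 w^2, which is at least 3/4 w^2 for
    [t >= 2]; the factor (1+v)^2 <= 4 turns 3/4 into 3/16. *)
Let slack : (1 + v) ^+ 2 * (1 + 3 / 16 * w ^+ 2) <= (1 + w) ^+ t.+1.
Proof.
apply: le_trans (bernoulli2 t (ltW w_gt0)).
have t2 : 2 <= t%:R :> R by rewrite ler_nat.
have v4 : (1 + v) ^+ 2 <= 4.
  by rewrite -[4](_ : 2 ^+ 2 = 4) ?lerXn2r ?nnegrE ?addr_ge0 ?(ltW v_gt0) //; have := v_le1; lra.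
have w2 : 0 <= w ^+ 2 by rewrite exprn_ge0 // ltW.
rewrite mulrDr mulr1.
have : (1 + v) ^+ 2 * (3 / 16 * w ^+ 2) <= 4 * (3 / 16 * w ^+ 2).
  by rewrite ler_wpM2r // mulr_ge0 // divr_ge0.
have -> : (1 + v) ^+ 2 = 1 + t.+1%:R * w + t.+1%:R ^+ 2 / 4 * w ^+ 2 by rewrite /v; field.
rewrite -[t.+1%:R]natr1 => h.
have : 0 <= (t%:R - 2) * (t%:R + 2) * w ^+ 2 by rewrite mulr_ge0 // mulr_ge0 //; lra.
move: h; move: (t%:R) (w ^+ 2) => T W; nra.
Qed.

(** As 1 + w = n/(n-e), this is [bin_max_term] divided by (n-e)^n, with [pack] bounding the binomial
    coefficient. *)
Let packing : (1 + w) ^+ n <= n.+1%:R * (q ^ (r + t.-1))%:R * y ^+ e.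
Proof.
have := bin_max_term (ltnW en); rewrite -(ler_nat R) !natrM !natrX => mt.
have -> : 1 + w = n%:R / (n - e)%:R.
  have -> : n%:R = (n - e)%:R + e%:R :> R by rewrite -natrD subnK // ltnW.
  by rewrite /w; field; rewrite lt0r_neq0.
rewrite expr_div_n ler_pdivrMr ?exprn_gt0 //; apply: le_trans mt _.
rewrite -!mulrA ler_wpM2l // expr_div_n expr_div_n.
have pk : 'C(n, e)%:R <= (q ^ (r + t.-1))%:R / (q - 1)%:R ^+ e :> R.
  by rewrite ler_pdivlMr ?exprn_gt0 // -natrX -natrM ler_nat.
apply: le_trans (ler_wpM2r _ pk) _; first by rewrite mulr_ge0 // exprn_ge0.
rewrite natrX le_eqVlt; apply/orP; left; apply/eqP.
have -> : (n - e)%:R ^+ n = (n - e)%:R ^+ e * (n - e)%:R ^+ (n - e) :> R.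
  by rewrite -exprD subnKC // ltnW.
field.
by rewrite !expf_neq0 // lt0r_neq0.
Qed.

Let base_leq : (q ^ t - 1)%:R <= b * (q ^ t.-1)%:R.
Proof.
have := geometric_leq t.-1 q_gt1; rewrite prednK ?(ltnW t_gt1) //.
by rewrite -(ler_nat R) !natrM /b; lra.
Qed.

(** The square of [covering] meets the [t.+1]-th power of [packing]. Apart from terms in [t] alone,
    the exponents of [q] differ by (t-1)(r - 2 rho). *)
Lemma covering_packing_inequality :
  (q ^ (2 * t * r))%:R * (1 + 3 / 16 * w ^+ 2) ^+ n <=
  (q ^ (2 * rho * t.-1 + t.+1 * (r + t.-1) + t) * (n.+1 ^ t.+1 * n ^ t))%:R.
Proof.
set P := (1 + 3 / 16 * w ^+ 2).
have k0 : 0 <= P.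
  by rewrite addr_ge0 // mulr_ge0 ?divr_ge0 // exprn_ge0 // ltW.
have v0 := ltW v_gt0; have w0 := ltW w_gt0; have y0 := ltW y_gt0; have b0 := ltW b_gt0.
have vy : v = b * y by rewrite /v /b /y; field; rewrite lt0r_neq0.
have H1 : (((q ^ t) ^ r)%:R * v ^+ rho) ^+ 2 <= ((q ^ t - 1)%:R ^+ rho * (1 + v) ^+ n) ^+ 2.
  by rewrite lerXn2r // nnegrE ?mulr_ge0 ?exprn_ge0 // addr_ge0.
have H2 : ((1 + v) ^+ n) ^+ 2 * P ^+ n <=
    (n.+1%:R * (q ^ (r + t.-1))%:R * y ^+ e) ^+ t.+1.
  apply: (@le_trans _ _ (((1 + w) ^+ n) ^+ t.+1)); last first.
    by rewrite lerXn2r // nnegrE ?mulr_ge0 ?exprn_ge0 // addr_ge0.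
  rewrite -!exprM mulnC [(n * t.+1)%N]mulnC !exprM -exprMn.
  by rewrite lerXn2r // nnegrE ?mulr_ge0 ?exprn_ge0 // addr_ge0.
have H3 : y ^+ (t.+1 * e) <= (n * q)%:R ^+ t * y ^+ (2 * rho).
  apply: (@le_trans _ _ (y ^+ (t.+1 * e) * ((n * q)%:R * y) ^+ t)).
    by rewrite ler_peMr ?exprn_ge0 // exprn_ege1.
  rewrite [((n * q)%:R * y) ^+ t]exprMn mulrCA -exprD ler_wpM2l ?exprn_ge0 //.
  by rewrite ler_wiXn2l.
have H4 : (q ^ t - 1)%:R ^+ (2 * rho) <= b ^+ (2 * rho) * (q ^ t.-1)%:R ^+ (2 * rho).
  by rewrite -[leRHS]exprMn lerXn2r // nnegrE // mulr_ge0.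
rewrite vy in H1 H2.
have := covering_packing_combine b_gt0 y_gt0 _ _ _ _ H1 H2 H3 H4.
rewrite !ler0n exprn_ge0 // mulr_ge0 // => /(_ isT isT isT isT).
rewrite -[((q ^ t) ^ r)%:R ^+ 2]natrX -!natrX -!natrM -!natrX -!natrM.
rewrite !expnMn -!expnM (_ : (t * (r * 2))%N = (2 * t * r)%N); last by rewrite mulnA mulnC mulnA.
move=> h; apply: le_trans h _; rewrite ler_nat.
rewrite (expnD q (_ + _)%N t) (expnD q (2 * rho * t.-1)).
rewrite [(t.-1 * _)%N]mulnC [((r + t.-1) * _)%N]mulnC; apply: eq_leq.
move: (q ^ (2 * _ * _))%N (q ^ (t.+1 * _))%N (q ^ t)%N (n.+1 ^ _)%N (n ^ t)%N.
by clear=> a1 a2 a3 a4 a5; lia.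
Qed.

End CoveringPacking.

Lemma covering_contradicts_packing (R : archiRealFieldType) (A K : nat) :
  exists N : nat, forall q t n r rho : nat,
  (N <= n)%N -> (n <= A * r)%N -> (r <= n)%N -> (1 < q)%N -> (1 < t)%N -> (t <= rho)%N ->
  (2 * rho + 3 <= r + t)%N -> (t <= r)%N -> (q ^ t <= K)%N ->
  ((q ^ t) ^ r <= \sum_(i < rho.+1) 'C(n, i) * (q ^ t - 1) ^ i)%N ->
  forall e : nat, e = ((2 * rho + 2) %/ t.+1)%N ->
  (q ^ (r + t.-1) < 'C(n, e) * (q - 1) ^ e)%N.
Proof.
case: (posnP A) => [->|A0]; first by exists 1%N => q t n r rho n0; rewrite mul0n; lia.
case: (posnP K) => [->|K0].
  by exists 0%N => q t n r rho _ _ _ q1 _ _ _ _; rewrite leqn0 expn_eq0; lia.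
(* If [r < 4 * rho], then [r <= 4 * K * e], so [n <= 4 * A * K * e] and [w] is at least [w0]. *)
pose w0 : R := 1 / (4 * (A * K)%:R).
have w0_gt0 : 0 < w0 by rewrite divr_gt0 // mulr_gt0 // ltr0n muln_gt0 A0.
pose kappa := 3 / 16 * w0 ^+ 2.
have k_gt0 : 0 < kappa by rewrite mulr_gt0 ?divr_gt0 ?exprn_gt0.
(* This yields (1 + kappa)^A <= 2, hence (1 + kappa)^n <= 2^r, so that the same growth bound serves
   both cases below. *)
have Ak : 2 * A%:R * kappa <= 1.
  have A1 : 1 <= A%:R :> R by rewrite ler1n.
  have K1 : 1 <= K%:R :> R by rewrite ler1n.
  have Aw : A%:R * w0 <= 1 / 4.
    have -> : A%:R * w0 = 1 / 4 * K%:R^-1.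
      by rewrite /w0 natrM; field; rewrite !pnatr_eq0 -!lt0n K0 A0.
    by rewrite -[leRHS]mulr1 ler_wpM2l ?divr_ge0 // invf_le1 ?ltr0n.
  have w1 : w0 <= 1 by apply: (@le_trans _ _ (A%:R * w0)); [rewrite ler_peMl // ltW | lra].
  have : A%:R * w0 * w0 <= 1 / 4 * 1.
    by apply: ler_pM => //; first rewrite mulr_ge0 //; apply: ltW.
  by rewrite /kappa expr2; lra.
(* The polynomial dominates the square of q^(2t^2) times the polynomial factor in [n], by
   [q ^ t <= K] and [t < K]; the square is needed when [4 * rho <= r]. *)
have [N Nexp] := exp_dominates_poly (4 * K) (K ^ (4 * K)) k_gt0.
exists (N + 10 * K)%N => q t n r rho Nn nA rn q1 t1 trho rhot tr qK vol e eE.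
rewrite ltnNge; apply/negP => pack.
have q0 := ltnW q1; have n0 : (0 < n)%N by lia.
have t10 : (0 < t.-1)%N by lia.
have r0 : (0 < r)%N by lia.
have tK : (t < K)%N by apply: leq_trans qK; apply: ltn_expl.
have e_le : (t.+1 * e <= 2 * rho + 2)%N by rewrite eE mulnC leq_trunc_div.
have e_ge : (2 * rho + 2 < t.+1 * e + t.+1)%N.
  by have := divn_eq (2 * rho + 2) t.+1; have := ltn_pmod (2 * rho + 2) (ltn0Sn t); rewrite -eE; lia.
have e2 : (1 < e)%N by rewrite -(ltn_pmul2l (ltn0Sn t)); lia.
have e3 : (3 * e <= t.+1 * e)%N by rewrite leq_mul2r; lia.
have en : (e < n)%N by lia.
have small_e : (t.+1 * e <= 2 * (n - e))%N by lia.
have rho_e : (2 * rho <= t.+1 * e + t)%N by lia.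
have rho_n : (rho <= n)%N by lia.
have := @covering_packing_inequality R q t n r rho e q1 t1 (ltnW e2) en small_e rho_e rho_n vol pack.
set w := e%:R / _ => main.
have := Nexp n (leq_trans (leq_addr _ _) Nn); set B := (_ * _)%N => big.
have nt : (n.+1 ^ t.+1 * n ^ t <= n.+1 ^ (2 * K))%N.
  apply: (@leq_trans (n.+1 ^ t.+1 * n.+1 ^ t)).
    by rewrite leq_mul2l leq_exp2r ?leqnSn ?orbT //; lia.
  by rewrite -expnD leq_pexp2l //; lia.
have qtK m : (q ^ (t * m) <= K ^ m)%N.
  by rewrite expnM; case: m => // m; rewrite leq_exp2r.
set X := (n.+1 ^ t.+1 * n ^ t)%N in nt main.
have X0 : (0 < X)%N by rewrite muln_gt0 !expn_gt0 n0.
have poly4 : (q ^ (4 * t * t) * (X * X) <= B)%N.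
  apply: leq_mul.
    by rewrite mulnC; apply: leq_trans (qtK _) _; rewrite leq_pexp2l //; lia.
  apply: leq_trans (leq_mul nt nt) _; rewrite -expnD leq_pexp2l //; lia.
have poly2 : (q ^ (2 * t * t) * X <= B)%N.
  apply: leq_trans _ poly4; apply: leq_mul; last by rewrite leq_pmulr.
  by rewrite leq_pexp2l // !leq_mul2r !orbT.
(* If [4 rho <= r], the factor [q^((t - 1)(r - 2 rho))] alone beats the polynomial one;
   otherwise [w >= w0] and [(1 + kappa)^n] does. *)
have [rho_small|rho_big] := leqP (4 * rho) r.
  have two : (1 + kappa) ^+ n <= (2 ^ r)%:R.
    apply: (@le_trans _ _ ((1 + kappa) ^+ (A * r))).
      by rewrite ler_weXn2l //; lra.
    rewrite exprM natrX lerXn2r ?nnegrE ?exprn_ge0 //; first by lra.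
    by rewrite exprD1_leq2 // ltW.
  have := lt_le_trans big two; rewrite ltr_nat ltnNge => /negP; apply.
  have main1 : (q ^ (2 * t * r) <= q ^ (2 * rho * t.-1 + t.+1 * (r + t.-1) + t) * X)%N.
    rewrite -(ler_nat R); apply: le_trans main.
    by rewrite ler_peMr // exprn_ege1 // lerDl mulr_ge0 ?divr_ge0 // exprn_ge0 // divr_ge0.
  have := leq_mul main1 main1; rewrite mulnACA -!expnD => main2.
  apply: (@leq_trans (q ^ (r * t.-1))).
    apply: (@leq_trans (2 ^ (r * t.-1))); first by rewrite leq_pexp2l // leq_pmulr.
    by rewrite leq_exp2r // muln_gt0 r0.
  apply: leq_trans _ poly4; have qa : (0 < q ^ (r * t.-1 + 2 * t.+1 * r))%N by rewrite expn_gt0 q0.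
  rewrite -(leq_pmul2l qa) mulnA -!expnD; apply: leq_trans (leq_trans _ main2) _.
    rewrite leq_pexp2l //; move: (ltnW t1); clear; case: t => // u _; nia.
  rewrite leq_mul2r leq_pexp2l ?orbT //.
  have := leq_mul rho_small (leqnn t.-1); move: (ltnW t1); clear; case: t => // u _ /=; nia.
move: big; rewrite ltNge => /negP; apply.
have w0_le : w0 <= w.
  rewrite ler_pdivlMr ?ltr0n ?subn_gt0 // /w0 mulrAC ler_pdivrMr; last first.
    by rewrite mulr_gt0 // ltr0n muln_gt0 A0.
  rewrite mul1r -!natrM ler_nat.
  have : (r <= 4 * K * e)%N.
    have := leq_mul tK (_ : e + 1 <= 2 * e)%N; move=> /(_ ltac:(lia)).
    by clear -rho_big e_ge; lia.
  by move=> /(leq_mul (leqnn A)); clear -nA; lia.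
have kw : kappa <= 3 / 16 * w ^+ 2.
  rewrite ler_wpM2l ?divr_ge0 // lerXn2r // nnegrE ltW //.
  exact: lt_le_trans w0_le.
apply: (@le_trans _ _ ((1 + 3 / 16 * w ^+ 2) ^+ n)).
  rewrite lerXn2r ?lerD2l // nnegrE addr_ge0 // ltW //.
  exact: lt_le_trans kw.
have Q0 : 0 < (q ^ (2 * t * r))%:R :> R by rewrite ltr0n expn_gt0 q0.
rewrite -(ler_pM2l Q0); apply: le_trans main _; rewrite -natrM ler_nat.
apply: leq_trans (leq_mul (leqnn _) poly2); rewrite mulnA -expnD leq_mul2r leq_pexp2l ?orbT //.
(* Here [2 * rho + 3 <= r + t] keeps the excess in the exponent of [q] below [2 * t * t]. *)
have := leq_mul rhot (leqnn t.-1); have := esym (prednK (ltnW t1)).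
move: (t.-1) => u ->; clear; nia.
Qed.

(** * Covering and packing for linear codes *)

Lemma wt_leq_card (F : finFieldType) (n t : nat) (V : 'M[F]_(t, n)) (J : {set 'I_n}) :
  (forall j, j \notin J -> col j V = 0) -> (wt V <= #|J|)%N.
Proof.
move=> VJ; apply/subset_leq_card/subsetP => j; rewrite inE; apply: contraR.
by move/VJ => ->.
Qed.

Lemma wt_le (F : finFieldType) (n t : nat) (V : 'M[F]_(t, n)) : (wt V <= n)%N.
Proof. by rewrite -[leqRHS]card_ord max_card. Qed.

(** The transpose of [V] factors through its rows indexed by the support of [V]. *)
Lemma rank_leq_wt (F : finFieldType) (n t : nat) (V : 'M[F]_(t, n)) :
  (\rank V <= wt V)%N.
Proof.
rewrite -mxrank_tr.
have -> : V^T = (\matrix_(j < n, i < #|[set j | col j V != 0]|)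
     (j == enum_val i)%:R) *m rowsub (fun i : 'I_(#|[set j | col j V != 0]|) => enum_val i) V^T.
  apply/matrixP => j a; rewrite !mxE.
  have [jJ|jJ] := boolP (j \in [set j | col j V != 0]).
    rewrite (bigD1 (enum_rank_in jJ j)) //= !mxE enum_rankK_in // eqxx mul1r.
    rewrite big1 ?addr0 // => i /negP ne; rewrite !mxE; case: eqP => [ej|]; rewrite ?mul0r //.
    by case: ne; apply/eqP/enum_val_inj; rewrite enum_rankK_in.
  move: (jJ); rewrite inE negbK => /eqP/matrixP/(_ a 0); rewrite !mxE => ->.
  rewrite big1 // => i _; rewrite !mxE; case: eqP => [ej|]; rewrite ?mul0r //.
  by rewrite ej enum_valP in jJ.
exact: leq_trans (mxrankM_maxr _ _) (rank_leq_row _).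
Qed.

Lemma bigminn_leq (I : finType) (P : pred I) (f : I -> nat) (d : nat) (i : I) :
  P i -> (\big[minn/d]_(j | P j) f j <= f i)%N.
Proof.
move=> Pi; elim: (index_enum I) (mem_index_enum i) => // j s IHs.
rewrite big_cons inE => /predU1P[<-|/IHs le_s]; first by rewrite Pi geq_minl.
by case: ifP => // _; apply: leq_trans le_s; apply: geq_minr.
Qed.

(** Some value being at most [d], the default cannot lie strictly below all values. *)
Lemma bigminn_attained (I : finType) (P : pred I) (f : I -> nat) (d : nat) (i : I) :
  P i -> (f i <= d)%N -> exists2 j, P j & (f j <= \big[minn/d]_(j | P j) f j)%N.
Proof.
move=> Pi fid.
elim/big_ind: _ => [|x y [j Pj jx] [l Pl ly]|j Pj]; first by exists i.
- case: (leqP x y) => xy; [exists j | exists l] => //.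
- by exists j.
Qed.

Lemma generator_matrix_exists (F : finFieldType) (n : nat) (C : {vspace 'rV[F]_n}) :
  exists2 G : 'M[F]_(\dim C, n), row_free G & forall v, (v \in C) = (v <= G)%MS.
Proof.
pose b := vbasis C; have bC := vbasisP C.
pose G : 'M[F]_(\dim C, n) := \matrix_i b`_i.
have mulE (u : 'rV_(\dim C)) : u *m G = \sum_i u 0 i *: b`_i.
  by rewrite mulmx_sum_row; apply: eq_bigr => i _; rewrite rowK.
exists G.
  rewrite -kermx_eq0; apply/eqP/row_matrixP => i; rewrite row0.
  have /sub_kermxP := row_sub i (kermx G); rewrite mulE => e0.
  apply/rowP => j; rewrite [RHS]mxE.
  by have /freeP/(_ _ e0) -> := basis_free bC.
move=> v; apply/idP/submxP => [vC | [u ->]].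
  exists (\row_i coord b i v); rewrite mulE {1}(coord_basis bC vC).
  by apply: eq_bigr => i _; rewrite mxE.
rewrite mulE; apply: memv_suml => i _; apply: memvZ.
by apply: vbasis_mem; rewrite mem_nth // size_tuple.
Qed.

Lemma code_powE (F : finFieldType) (n k t : nat) (C : {vspace 'rV[F]_n})
    (G : 'M[F]_(k, n)) (V : 'M[F]_(t, n)) :
  (forall v, (v \in C) = (v <= G)%MS) -> (V \in code_pow C t) = (V <= G)%MS.
Proof.
by move=> GC; rewrite inE; apply/forallP/row_subP => H i; rewrite ?GC // -GC.
Qed.

Lemma leq_rank_mulmx (F : fieldType) (m n t : nat) (A : 'M[F]_(m, n)) :
  (t <= \rank A)%N -> exists W : 'M[F]_(t, m), \rank (W *m A) = t.
Proof.
move=> tA; pose P : 'M[F]_(t, \rank A) := pid_mx t.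
exists (P *m rowsub (maxrankfun A) 1%:M).
rewrite -mulmxA -rowsubE.
by rewrite mxrankMfree ?maxrowsub_free // rank_pid_mx.
Qed.

(** * Counting matrices by weight *)

Lemma card_support (F : finFieldType) (n t : nat) (S : {set 'I_n}) :
  #|[set V : 'M[F]_(t, n) | [set j | col j V != 0] == S]| = ((#|F| ^ t - 1) ^ #|S|)%N.
Proof.
have <- : #|predC1 (0 : 'cV[F]_t)| = (#|F| ^ t - 1)%N.
  by have := cardC1 (0 : 'cV[F]_t); rewrite card_mx muln1 -subn1.
rewrite -(card_pffun_on 0 S (predC1 (0 : 'cV[F]_t))).
(* Encode a matrix by the function sending [j] to its column; support [S] means nonzero values
   exactly on [S]. *)
rewrite -(card_imset _ (f := fun V : 'M[F]_(t, n) => [ffun j => col j V])); last first.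
  move=> V W /ffunP VW; apply/matrixP => i j.
  by have /colP/(_ i) := VW j; rewrite !ffunE !mxE.
apply: eq_card => f; apply/imsetP/pffun_onP => [[V] | [fS f0]].
  rewrite inE => /eqP <- ->; split.
    by apply/subsetP => j; rewrite !inE ffunE.
  by move=> x /imageP[j]; rewrite !inE => jV ->; rewrite ffunE.
exists (\matrix_(i, j) f j i 0); last first.
  by apply/ffunP => j; rewrite ffunE; apply/colP => i; rewrite !mxE.
have cE j : col j (\matrix_(i, j) f j i 0) = f j by apply/colP => i; rewrite !mxE.
rewrite inE; apply/eqP/setP => j; rewrite inE cE.
apply/idP/idP => [fj | jS].
  by apply: (subsetP fS); rewrite inE.
by have := f0 (f j) (image_f f jS); rewrite inE.
Qed.

Lemma card_wt (F : finFieldType) (n t i : nat) :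
  #|[set V : 'M[F]_(t, n) | wt V == i]| = ('C(n, i) * (#|F| ^ t - 1) ^ i)%N.
Proof.
rewrite -sum1_card (partition_big (fun V : 'M[F]_(t, n) => [set j | col j V != 0])
  (fun S : {set 'I_n} => #|S| == i)) /=; last by move=> V; rewrite inE.
rewrite (eq_bigr (fun=> (#|F| ^ t - 1) ^ i)%N) => [|S /eqP Si].
  have -> : 'C(n, i) = #|[set S : {set 'I_n} | #|S| == i]| by rewrite card_draws card_ord.
  by rewrite -sum_nat_const; apply: eq_bigl => S; rewrite inE.
rewrite -[in RHS]Si -(card_support F t S) -[RHS]sum1_card; apply: eq_bigl => V; rewrite !inE.
by rewrite andb_idl // => /eqP VS; rewrite /wt VS Si.
Qed.

Lemma card_ball (F : finFieldType) (n t e : nat) :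
  #|[set V : 'M[F]_(t, n) | wt V <= e]%N| =
  (\sum_(i < e.+1) 'C(n, i) * (#|F| ^ t - 1) ^ i)%N.
Proof.
rewrite -sum1_card (partition_big (fun V : 'M[F]_(t, n) => inord (wt V) : 'I_e.+1) xpredT) //=.
apply: eq_bigr => i _; rewrite -card_wt -sum1_card; apply: eq_bigl => V.
rewrite !inE; have ie := ltn_ord i; apply/andP/eqP => [[Ve /eqP <-] | Vi].
  by rewrite inordK.
by rewrite Vi inord_val eqxx -ltnS.
Qed.

Lemma card_row_space (F : finFieldType) (t k n : nat) (G : 'M[F]_(k, n)) :
  row_free G -> #|[set V : 'M[F]_(t, n) | (V <= G)%MS]| = (#|F| ^ (t * k))%N.
Proof.
move=> fG; rewrite -card_mx -(card_imset (f := fun A : 'M[F]_(t, k) => A *m G)); last first.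
  exact: row_free_inj.
apply: eq_card => V; rewrite inE; apply/submxP/imsetP => [[A ->]|[A _ ->]].
  by exists A.
by exists A.
Qed.

(** * Consequences of a covering *)

Section Covering.
Variables (F : finFieldType) (k n : nat) (G : 'M[F]_(k, n)) (t rho : nat).
Hypothesis fG : row_free G.
Hypothesis cover : forall V : 'M[F]_(t, n), exists2 W, (W <= G)%MS & (wt (V - W) <= rho)%N.

(** Adding a ball element to a code matrix reaches every matrix; the number of code matrices is then
    cancelled. *)
Lemma sphere_covering :
  (#|F| ^ (t * (n - k)) <= \sum_(i < rho.+1) 'C(n, i) * (#|F| ^ t - 1) ^ i)%N.
Proof.
rewrite -card_ball -(@leq_pmul2l (#|F| ^ (t * k))); last first.
  by rewrite expn_gt0; apply/orP; left; apply/card_gt0P; exists 0.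
have kn : (k <= n)%N by rewrite -(eqP fG) rank_leq_col.
rewrite -expnD -mulnDr subnKC // -(card_mx F) -(card_row_space t fG) -cardsX.
set X := setX _ _.
have -> : #|{: 'M[F]_(t, n)}| = #|[set p.1 + p.2 | p in X]|.
  apply: eq_card => V; symmetry; apply/imsetP; have [W WG VW] := cover V.
  by exists (W, V - W); rewrite ?inE //= ?WG //= addrC subrK.
exact: leq_imset_card.
Qed.

(** Take [V] whose syndrome, its product with [cokermx G], has rank [t]. Subtracting a code matrix
    does not change the syndrome, so every [V - W] has rank, hence weight, at least [t]. *)
Lemma covering_radius_ge : (t <= n - k)%N -> (t <= rho)%N.
Proof.
rewrite -(eqP fG) -mxrank_coker => /leq_rank_mulmx[V Vt].
have [W WG VW] := cover V; apply: leq_trans VW; apply: leq_trans (rank_leq_wt _).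
apply: leq_trans (mxrankM_maxl _ (cokermx G)); rewrite mulmxBl.
by move: WG; rewrite submxE => /eqP ->; rewrite subr0 Vt.
Qed.

End Covering.

(** * Systematic generators and random matrices *)

Lemma row_free_rowsub (F : fieldType) (m k n : nat) (h : 'I_m -> 'I_k) (A : 'M[F]_(k, n)) :
  injective h -> row_free A -> row_free (rowsub h A).
Proof.
move=> hI fA; rewrite rowsubE /row_free mxrankMfree //.
apply/row_freeP; exists (rowsub h 1%:M)^T; apply/matrixP => i j; rewrite !mxE.
rewrite (bigD1 (h i)) //= !mxE eqxx mul1r (inj_eq hI) eq_sym big1 ?addr0 // => l lh.
by rewrite !mxE eq_sym (negPf lh) mul0r.
Qed.

Lemma systematic_matrix_exists (F : fieldType) (k n : nat) (G : 'M[F]_(k, n)) : row_free G ->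
  exists (f : 'I_k -> 'I_n) (S : 'M[F]_(k, n)),
    [/\ injective f, colsub f S = 1%:M & (S <= G)%MS].
Proof.
move=> fG; have GT : row_full G^T by rewrite /row_full mxrank_tr.
pose f := fullrankfun GT; have := fullrowsub_unit GT.
rewrite -/f -unitmx_tr (_ : (rowsub f G^T)^T = colsub f G); last first.
  by apply/matrixP => i j; rewrite !mxE.
move=> uG; exists f, (invmx (colsub f G) *m G); split.
- exact: fullrankfun_inj.
- rewrite -[RHS](mulVmx uG); apply/matrixP => i j; rewrite !mxE.
  by apply: eq_bigr => l _; rewrite !mxE.
- exact: submxMl.
Qed.

Lemma row_free_colsub1 (F : fieldType) (k n : nat) (f : 'I_k -> 'I_n) (S : 'M[F]_(k, n)) :
  colsub f S = 1%:M -> row_free S.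
Proof.
move=> fS; apply/row_freeP; exists (rowsub f 1%:M)^T.
rewrite -fS; apply/matrixP => i j; rewrite !mxE (bigD1 (f j)) //= !mxE eqxx mulr1.
by rewrite big1 ?addr0 // => l lf; rewrite !mxE eq_sym (negPf lf) mulr0.
Qed.

(** The map from [M] to [p *m M] is onto, and its fibres are translates of the kernel. *)
Lemma card_mulmx_eq0 (F : finFieldType) (g c : nat) (p : 'rV[F]_g) : p != 0 ->
  (#|[set M : 'M[F]_(g, c) | p *m M == 0%R]| * #|F| ^ c = #|F| ^ (g * c))%N.
Proof.
move=> p0; rewrite -(card_mx F g c) -[RHS]sum1_card.
rewrite (partition_big (fun M : 'M_(g, c) => p *m M) xpredT) //=.
rewrite (eq_bigr (fun=> #|[set M : 'M[F]_(g, c) | p *m M == 0%R]|)) => [|b _].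
  by rewrite sum_nat_const card_mx mul1n mulnC.
have fp : row_full p^T.
  by rewrite /row_full mxrank_tr eqn_leq rank_leq_row lt0n mxrank_eq0.
have [B0 pB0] : exists B0 : 'M_(g, c), p *m B0 = b.
  have /submxP[D Db] : (b^T <= p^T)%MS by apply: submx_full.
  by exists D^T; rewrite -[p]trmxK -trmx_mul -Db trmxK.
rewrite sum1_card -[RHS](card_imset _ (addIr B0)); apply: eq_card => M.
apply/idP/imsetP => [MK|[N]].
  have pM : p *m M = b by apply/eqP.
  by exists (M - B0); rewrite ?subrK // inE mulmxBr pM pB0 subrr.
by rewrite inE => /eqP pN ->; apply/eqP; rewrite mulmxDr pN pB0 add0r.
Qed.

(** Union bound: a matrix of rank below [c] is killed by some nonzero [v], and each [v] kills a
    fraction q^-g of all matrices. *)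
Lemma card_not_row_full (F : finFieldType) (g c : nat) : (0 < g)%N ->
  (#|[set M : 'M[F]_(g, c) | \rank M != c]| * #|F| ^ g <= #|F| ^ c * #|F| ^ (g * c))%N.
Proof.
move=> g_gt0.
pose K (v : 'rV[F]_c) := [set M : 'M[F]_(g, c) | v *m M^T == 0%R].
apply: (@leq_trans ((\sum_(v : 'rV[F]_c | v != 0) #|K v|) * #|F| ^ g)).
  rewrite leq_mul2r; apply/orP; right.
  apply: (@leq_trans #|\bigcup_(v : 'rV[F]_c | v != 0) K v|); last first.
    elim/big_ind2: _ => [|B x D z Bx Dz|//]; first by rewrite cards0.
    exact: leq_trans (leq_card_setU _ _) (leq_add Bx Dz).
  apply/subset_leq_card/subsetP => M; rewrite inE -mxrank_tr => Mc.
  have : kermx M^T != 0 by rewrite kermx_eq0.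
  case/rowV0Pn => v /sub_kermxP vM v0; apply/bigcupP; exists v => //.
  by rewrite inE vM.
rewrite big_distrl /=.
apply: (@leq_trans (\sum_(v : 'rV[F]_c | v != 0) #|F| ^ (g * c))).
  apply: leq_sum => v v0; rewrite [(g * c)%N]mulnC -(card_mulmx_eq0 g v0).
  rewrite leq_mul2r; apply/orP; right; rewrite -[leqLHS](card_imset _ (@trmx_inj _ g c)).
  by apply/subset_leq_card/subsetP => M /imsetP[N]; rewrite !inE => vN ->.
rewrite sum_nat_const leq_mul2r; apply/orP; right.
by apply: leq_trans (max_card _) _; rewrite card_mx mul1n.
Qed.

(** * Consequences of a generalized weight *)

Section Weight.
Variables (F : finFieldType) (k n : nat) (G : 'M[F]_(k, n)) (t d : nat).
Hypothesis fG : row_free G.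
Hypothesis weight : forall V : 'M[F]_(t, n), (V <= G)%MS -> \rank V = t -> (d <= wt V)%N.

Lemma weight_leq (m : nat) (A : 'M[F]_(m, n)) (J : {set 'I_n}) :
  (A <= G)%MS -> (t <= \rank A)%N -> (forall j, j \notin J -> col j A = 0) ->
  (d <= #|J|)%N.
Proof.
move=> AG /leq_rank_mulmx[W Wt] AJ.
apply: leq_trans (weight (submx_trans (submxMl W A) AG) Wt) _.
apply: wt_leq_card => j /AJ e.
by rewrite colE -mulmxA -colE e mulmx0.
Qed.

(* A coset meeting the ball in more than [q^(t-1)] points contains [t.+1] of them whose
   differences span a subcode of dimension [t], supported on at most [t.+1 * e] coordinates. *)
Lemma sphere_packing (e : nat) : (0 < t)%N -> (t.+1 * e < d)%N ->
  (#|[set v : 'rV[F]_n | wt v <= e]%N| <= #|F| ^ (n - k + t.-1))%N.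
Proof.
move=> t_gt0 te_d; rewrite leqNgt; apply/negP => ball_big.
have q_gt0 m : (0 < #|F| ^ m)%N by rewrite expn_gt0; apply/orP; left; apply/card_gt0P; exists 0.
have kn : (k <= n)%N by rewrite -(eqP fG) rank_leq_col.
pose S (y : 'rV[F]_n) := [set v : 'rV[F]_n | (v <= G)%MS && (wt (y - v) <= e)%N].
(* Otherwise, counting the pairs of a ball vector and a codeword by their sum bounds the ball size
   times q^k by q^n q^(t-1). *)
have [y Sy] : exists y, (#|F| ^ t.-1 < #|S y|)%N.
  apply/existsP; apply: contraLR ball_big => /existsPn Ssmall; rewrite -leqNgt.
  rewrite -(leq_pmul2r (q_gt0 k)).
  have := card_row_space 1 fG; rewrite mul1n => <-; rewrite -cardsX.
  set X := setX _ _.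
  rewrite -sum1_card (partition_big (fun p : 'rV[F]_n * 'rV[F]_n => p.1 + p.2) xpredT) //=.
  apply: (@leq_trans (\sum_(y : 'rV[F]_n) #|F| ^ t.-1)).
    apply: leq_sum => y _; have := Ssmall y; rewrite -leqNgt; apply: leq_trans.
    rewrite sum1_card -(card_in_imset (f := snd)).
      apply/subset_leq_card/subsetP => v /imsetP[[u w]]; rewrite unfold_in !inE /= => /andP[/andP[ue wG] /eqP <-] ->.
      by rewrite wG addrK.
    move=> [u w] [u' w']; rewrite !unfold_in /= => /andP[_ /eqP e1] /andP[_ /eqP e2] /= ww.
    by congr pair => //; apply: (addIr w); rewrite e1 ww e2.
  rewrite sum_nat_const card_mx (card_row_space 1 fG) !mul1n -!expnD leq_exp2l; last exact: card_finNzRing_gt1.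
  by lia.
have [c0 c0S] : exists c0, c0 \in S y by apply/card_gt0P; apply: leq_trans Sy.
pose A := \matrix_(i < #|S y|) (enum_val i - c0).
(* The row space of [A] contains the [#|S y|] distinct differences [c - c0], too many for dimension
   [t.-1]. *)
have tA : (t <= \rank A)%N.
  rewrite -(prednK t_gt0) -(ltn_exp2l _ _ (card_finNzRing_gt1 F)); apply: leq_trans Sy _.
  have := card_row_space 1 (row_base_free A); rewrite mul1n => <-.
  rewrite -[leqLHS](card_imset _ (addIr (- c0))).
  apply/subset_leq_card/subsetP => v /imsetP[c cS ->]; rewrite inE eq_row_base.
  have -> : c - c0 = row (enum_rank_in cS c) A by rewrite rowK enum_rankK_in.
  exact: row_sub.
pose f (i : 'I_t) := maxrankfun A (widen_ord tA i).
have fA : row_free (rowsub f A).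
  rewrite /f (_ : rowsub _ A = rowsub (widen_ord tA) (rowsub (maxrankfun A) A)).
    apply: row_free_rowsub (maxrowsub_free A) => i j /(congr1 val) /= ij; exact: val_inj.
  by apply/matrixP => i j; rewrite !mxE.
have SP c : c \in S y -> (c <= G)%MS /\ (wt (y - c)%R <= e)%N by rewrite inE => /andP.
(* Each difference [c - c0] equals [(y - c0) - (y - c)], so the [t] chosen ones live on [t.+1]
   supports of size at most [e]. *)
pose J := [set j | col j (y - c0) != 0] :|:
  \bigcup_(i < t) [set j | col j (y - enum_val (f i)) != 0].
rewrite ltnNge in te_d; case/negP: te_d.
apply: (@leq_trans #|J|); last first.
  apply: leq_trans (leq_card_setU _ _) _; rewrite mulSn; apply: leq_add.
    by have [] := SP _ c0S.
  apply: (@leq_trans (\sum_(i < t) e)); last by rewrite sum_nat_const card_ord.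
  elim/big_ind2: _ => [|B x D z Bx Dz|i _]; first by rewrite cards0.
    exact: leq_trans (leq_card_setU _ _) (leq_add Bx Dz).
  by have [] := SP _ (enum_valP (f i)).
apply: (weight_leq (A := rowsub f A)); last 1 first.
- move=> j; rewrite inE negb_or inE negbK => /andP[/eqP e0 /bigcupP eJ].
  apply/colP => i; rewrite !mxE.
  have /eqP ei : col j (y - enum_val (f i)) == 0.
    by apply: contra_notT eJ => ei; exists i; rewrite ?inE.
  move/colP/(_ 0): e0; move/colP/(_ 0): ei; rewrite !mxE => ei e0.
  have -> : enum_val (f i) 0 j - c0 0 j = (y 0 j - c0 0 j) - (y 0 j - enum_val (f i) 0 j).
    by rewrite opprB [RHS]addrC addrA subrK.
  by rewrite e0 ei subr0.
- apply/row_subP => i; rewrite row_rowsub rowK.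
  have [cG _] := SP _ (enum_valP (f i)); have [c0G _] := SP _ c0S.
  by rewrite addmx_sub // eqmx_opp.
- by rewrite (eqP fA).
Qed.

(** Combinations of the [m] rows of [S] picked by [s] that vanish on the columns [h] form a subcode
    of dimension at least [t]. It also vanishes on the systematic coordinates of the other [k - m]
    rows. *)
Lemma weight_leq_defect (g m : nat) (f : 'I_k -> 'I_n) (S : 'M[F]_(k, n))
    (h : 'I_g -> 'I_n) (s : 'I_m -> 'I_k) :
  injective f -> colsub f S = 1%:M -> (S <= G)%MS ->
  injective h -> injective s -> (forall i j, h i != f j) ->
  (t + \rank (rowsub s (colsub h S)) <= m)%N -> (d + g <= n - k + m)%N.
Proof.
move=> fI fS SG hI sI hf tm.
have kn : (k <= n)%N by rewrite -(eqP fG) rank_leq_col.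
have mk : (m <= k)%N by rewrite -[m]card_ord -[k]card_ord; apply: leq_card sI.
pose U := h @: setT :|: f @: (~: (s @: setT)).
have cU : #|U| = (g + (k - m))%N.
  rewrite cardsU (_ : h @: setT :&: _ = set0) ?cards0 ?subn0.
    rewrite !card_imset // cardsT card_ord; congr addn.
    by rewrite cardsCs setCK card_imset // cardsT !card_ord.
  apply/setP => j; rewrite !inE; apply/negbTE/andP => -[/imsetP[i _ ->] /imsetP[l _]].
  by apply/eqP.
have Un : (#|U| <= n)%N by rewrite -[leqRHS]card_ord max_card.
suff : (d <= #|~: U|)%N by rewrite cardsCs setCK cU card_ord; lia.
pose A := kermx (rowsub s (colsub h S)) *m rowsub s S.
apply: (weight_leq (A := A)).
- by apply: submx_trans SG; apply: submx_trans (submxMl _ _) _; rewrite rowsubE submxMl.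
- rewrite mxrankMfree ?row_free_rowsub ?(row_free_colsub1 fS) // mxrank_ker; lia.
- move=> j; rewrite inE negbK /U inE => /orP[/imsetP[i _ ->]|/imsetP[l]].
    have := mulmx_ker (rowsub s (colsub h S)) => /matrixP e0.
    apply/colP => a; move: (e0 a i); rewrite !mxE => {}e0; rewrite -[RHS]e0.
    by apply: eq_bigr => b _; rewrite !mxE.
  rewrite inE => ls ->; apply/colP => a; rewrite !mxE big1 // => b _.
  rewrite !mxE; have := congr1 (fun M : 'M_k => M (s b) l) fS; rewrite !mxE => ->.
  case: eqP => [e|_]; last by rewrite mulr0.
  by rewrite -e imset_f in ls.
Qed.

(** The case [g = 0], [m = t] of [weight_leq_defect]. *)
Lemma singleton_bound : (t <= k)%N -> (d <= n - k + t)%N.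
Proof.
move=> tk; have [f [S [fI fS SG]]] := systematic_matrix_exists fG.
rewrite -[d]addn0.
have hI : injective (fun i : 'I_0 => f (widen_ord (leq0n k) i)) by case.
have sI : injective (widen_ord tk) by move=> i j /(congr1 val) /= ij; apply: val_inj.
apply: (weight_leq_defect fI fS SG hI sI); first by case.
by rewrite (_ : rowsub _ _ = 0) ?mxrank0 ?addn0 //; apply/matrixP => i [].
Qed.

(* Restrict the redundancy part of a systematic generator matrix to [c + l] columns. A random
   matrix [M] kills each of its rows with probability at least [q^-c], so some [M] of rank [c]
   kills [t + l] rows; these have rank at most [l], which leaves a subcode of dimension [t]
   vanishing on all [c + l] columns. *)
Lemma defect_bound (c l : nat) : (0 < t)%N -> (0 < c)%N -> (c + l <= n - k)%N ->
  ((t + l) * #|F| ^ (c + l) + k * #|F| ^ c < k * #|F| ^ l + #|F| ^ (c + l))%N ->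
  (d + c <= n - k + t)%N.
Proof.
move=> t_gt0 c_gt0; set g := (c + l)%N => gr big_k.
have [f [S [fI fS SG]]] := systematic_matrix_exists fG.
have kn : (k <= n)%N by rewrite -(eqP fG) rank_leq_col.
have cf : #|~: (f @: setT)| = (n - k)%N.
  by rewrite cardsCs setCK card_imset // cardsT !card_ord.
pose h (i : 'I_g) := enum_val (cast_ord (esym cf) (widen_ord gr i)).
have hI : injective h.
  by move=> i j /enum_val_inj /cast_ord_inj /(congr1 val) /= ij; apply: val_inj.
have hf i j : h i != f j.
  have := enum_valP (cast_ord (esym cf) (widen_ord gr i)); rewrite -/(h i) inE.
  by apply: contraNneq => ->; rewrite imset_f.
pose P := colsub h S.
pose Z (M : 'M[F]_(g, c)) := [set i | row i P *m M == 0].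
have q_gt0 m : (0 < #|F| ^ m)%N by rewrite expn_gt0; apply/orP; left; apply/card_gt0P; exists 0.
have [M rM ZM] : exists2 M : 'M[F]_(g, c), \rank M = c & (t + l <= #|Z M|)%N.
  suff /existsP[M /andP[/eqP ? ?]] : [exists M : 'M[F]_(g, c), (\rank M == c) && (t + l <= #|Z M|)%N].
    by exists M.
  apply: contraLR big_k => /existsPn small; rewrite -leqNgt.
  (* Double counting of the pairs of a row of [P] and a matrix [M] killing it; a zero row is killed
     by all matrices. *)
  have tot : (k * #|F| ^ (g * c) <= (\sum_(M : 'M[F]_(g, c)) #|Z M|) * #|F| ^ c)%N.
    rewrite (eq_bigr (fun M => \sum_(i < k) (row i P *m M == 0)%R)%N); last first.
      by move=> M _; rewrite -sum1dep_card big_mkcond; apply: eq_bigr => i _; case: eqP.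
    rewrite exchange_big /= big_distrl /= -[k in (k * _)%N]card_ord -sum_nat_const.
    apply: leq_sum => i _; rewrite (_ : \sum_M _ = #|[set M : 'M[F]_(g, c) | row i P *m M == 0%R]|)%N; last first.
      by rewrite -sum1dep_card [RHS]big_mkcond; apply: eq_bigr => M _; case: eqP.
    have [->|p0] := eqVneq (row i P) 0; last by rewrite card_mulmx_eq0.
    rewrite (_ : [set M | _] = setT); first by rewrite cardsT card_mx leq_pmulr.
    by apply/setP => M; rewrite !inE mul0mx eqxx.
  (* By [small], a matrix of rank [c] kills fewer than [t + l] rows; for the others the trivial
     bound [k] is used. *)
  have bnd : (\sum_(M : 'M[F]_(g, c)) #|Z M| + #|F| ^ (g * c) <=
      (t + l) * #|F| ^ (g * c) + k * #|[set M : 'M[F]_(g, c) | \rank M != c]|)%N.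
    rewrite -(card_mx F) -[X in (X <= _)%N](_ : \sum_(M : 'M[F]_(g, c)) (#|Z M| + 1) = _)%N; last first.
      by rewrite big_split /= sum1_card.
    rewrite mulnC -sum_nat_const [(k * _)%N]mulnC -sum_nat_const.
    rewrite [X in (_ <= _ + X)%N](_ : _ = \sum_(M : 'M[F]_(g, c)) k * (\rank M != c))%N; last first.
      by rewrite big_mkcond; apply: eq_bigr => M _; rewrite inE; case: eqP; rewrite ?muln0 ?muln1.
    rewrite -big_split /=; apply: leq_sum => M _.
    have := small M; rewrite negb_and; case: eqP => /= _.
      by rewrite -ltnNge muln0 addn0 addn1.
    have Zk : (#|Z M| <= k)%N by rewrite -[leqRHS]card_ord max_card.
    by move=> _; rewrite muln1 addnC leq_add ?(leq_trans t_gt0) ?leq_addr.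
  have g_gt0 : (0 < g)%N by rewrite /g; lia.
  have nf := card_not_row_full F c g_gt0.
  set q := #|F| in tot bnd nf q_gt0 *.
  have qg : (q ^ g = q ^ c * q ^ l)%N by rewrite expnD.
  rewrite -(leq_pmul2r (q_gt0 (g * c)%N)).
  have h1 : (k * q ^ (g * c) * q ^ l <= (\sum_(M : 'M[F]_(g, c)) #|Z M|) * q ^ g)%N.
    by rewrite qg mulnA leq_mul2r tot orbT.
  have := leq_mul bnd (leqnn (q ^ g)); move: h1 nf.
  move: (\sum_M _)%N #|_| (q ^ (g * c))%N (q ^ g)%N (q ^ l)%N (q ^ c)%N => X N B Qg Ql Qc.
  by nia.
pose T := fun i : 'I_(t + l) => enum_val (widen_ord ZM i).
have TI : injective T.
  by move=> i j /enum_val_inj /(congr1 val) /= ij; apply: val_inj.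
have : (t + \rank (rowsub T P) <= t + l)%N.
  have TP : rowsub T P *m M = 0.
    apply/row_matrixP => i; rewrite row_mul row_rowsub row0.
    by have := enum_valP (widen_ord ZM i); rewrite inE => /eqP.
  (* The rows lie in the left kernel of [M], of dimension [g - c = l]. *)
  have := mulmx0_rank_max TP; rewrite rM /g; lia.
move/(weight_leq_defect fI fS SG hI TI hf); rewrite /g; lia.
Qed.

End Weight.

(** * Bounded rate and conclusion *)

Lemma length_leq_redundancy (R : archiRealFieldType) (alpha : R) : alpha < 1 ->
  exists A : nat, forall n k : nat, (k <= n)%N -> k%:R / n%:R <= alpha -> (n <= A * (n - k))%N.
Proof.
(* The rate condition says n - k >= (1 - alpha) n, so any integer above 1/(1 - alpha) works. *)
move=> a1; exists (Num.Def.archi_bound (1 - alpha)^-1) => n k kn rate.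
have a0 : 0 < 1 - alpha by rewrite subr_gt0.
have [->//|n_gt0] := posnP n.
have bA : 1 <= (Num.Def.archi_bound (1 - alpha)^-1)%:R * (1 - alpha).
  by rewrite -ler_pdivrMr // div1r ltW // archi_boundP // invr_ge0 ltW.
rewrite -(ler_nat R) natrM natrB //.
apply: (@le_trans _ _ ((Num.Def.archi_bound (1 - alpha)^-1)%:R * ((1 - alpha) * n%:R))).
  by rewrite mulrA ler_peMl.
rewrite ler_wpM2l // mulrBl mul1r lerD2l lerN2.
by rewrite -ler_pdivrMr // ltr0n.
Qed.

Theorem theorem16 (R : realType) (alpha : R) (alpha_gt0 : 0 < alpha)
    (alpha_lt1 : alpha < 1) :
  exists N : nat,
    forall (F : finFieldType) (n k : nat) (C : {vspace 'rV[F]_n}),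
      (N <= n)%N ->
      \dim C = k ->
      k%:R / n%:R <= alpha ->
      forall t : nat,
        (1 <= t <= minn k (n - k))%N ->
        (gen_packing_radius C t <= gen_covering_radius C t)%N.
Proof.
have [A nA] := length_leq_redundancy alpha_lt1.
have [N1 low] := covering_contradicts_packing R A (16 ^ A).
have [N2 high] := covering_contradicts_defect A (16 ^ A).
exists (N1 + N2)%N => F n k C Nn dimC rate t /andP[t_gt0]; rewrite leq_min => /andP[tk tr].
rewrite leqNgt; apply/negP; set rho := gen_covering_radius C t => gap.
pose d := gen_weight C t.
(* The gap gives (d - 1)/2 >= rho + 1 after rounding down, hence d - 1 >= 2 rho + 2. *)
have dE : (2 * rho + 3 <= d)%N by move: gap; rewrite /gen_packing_radius -/d; lia.
have [G fG GC] := generator_matrix_exists C; rewrite dimC in G fG GC.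
have weight (V : 'M[F]_(t, n)) : (V <= G)%MS -> \rank V = t -> (d <= wt V)%N.
  move=> VG Vt; apply: (@bigminn_leq _ _ _ n V); rewrite Vt eqxx andbT.
  by rewrite (code_powE _ GC).
have cover (V : 'M[F]_(t, n)) : exists2 W, (W <= G)%MS & (wt (V - W)%R <= rho)%N.
  pose m := \big[minn/n]_(W in code_pow C t) mxdist V W.
  have m_rho : (m <= rho)%N := @leq_bigmax _ (fun V => \big[minn/n]_(W in code_pow C t) mxdist V W) V.
  have C0 : 0 \in code_pow C t by rewrite (code_powE _ GC) sub0mx.
  have [W WC Wm] := bigminn_attained (P := fun W => W \in code_pow C t) (f := mxdist V) C0 (wt_le _).
  by exists W; [rewrite -(code_powE _ GC) | exact: leq_trans m_rho].
have kn : (k <= n)%N by rewrite -(eqP fG) rank_leq_col.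
have q1 := card_finNzRing_gt1 F; have {}nA := nA n k kn rate.
have rn : (n - k <= n)%N := leq_subr _ _.
have d_sing := singleton_bound fG weight tk.
have trho : (t <= rho)%N := covering_radius_ge fG cover tr.
have vol := sphere_covering fG cover; rewrite expnM in vol.
have rho_small : (2 * rho + 3 <= n - k + t)%N := leq_trans dE d_sing.
have rho_n : (rho <= n)%N by lia.
have rho_r : (rho <= n - k)%N by lia.
have [t1|t1] := leqP t 1.
  have t1E : t = 1%N by lia.
  (* For [t = 1] the radius [rho.+1] satisfies 2(rho + 1) < d, and the packing bound q^(n-k) is
     exceeded: the ball of radius [rho] already has that size, and the sphere of radius [rho.+1] is
     nonempty. *)
  have := sphere_packing fG weight (e := rho.+1) t_gt0; rewrite t1E addn0 => /(_ ltac:(lia)).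
  rewrite card_ball big_ord_recr /= leqNgt => /negP; apply.
  rewrite t1E !expn1 in vol *; rewrite -addn1 leq_add //.
  rewrite muln_gt0 bin_gt0 expn_gt0 subn_gt0 q1 andbT; lia.
have r_gt0 : (0 < n - k)%N by lia.
have Q_gt0 : (0 < #|F| ^ t)%N by rewrite expn_gt0 ltnW.
have [tK|rK] := volume_dichotomy rho_n rho_r Q_gt0 vol (ltnW q1) (erefl _) r_gt0 nA tr rho_small.
- have := low _ _ _ _ _ (leq_trans (leq_addr _ _) Nn) nA rn q1 t1 trho rho_small tr tK vol _ (erefl _).
  set e := (_ %/ _)%N; rewrite ltnNge => /negP; apply.
  have e_small : (t.+1 * e < d)%N.
    by have := leq_trunc_div (2 * rho + 2) t.+1; rewrite -/e; lia.
  apply: leq_trans (sphere_packing fG weight t_gt0 e_small).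
  (* Only the sphere of radius [e] inside the ball is counted, as [low] concerns this single
     term. *)
  have := card_wt F n 1 e; rewrite expn1 => <-.
  by apply/subset_leq_card/subsetP => v; rewrite !inE => /eqP ->.
- have [c [l [c_gt0 cl far dense]]] := high _ _ _ _ _ _ (leq_trans (leq_addl _ _) Nn) nA
    (esym (subnK kn)) q1 tr trho rho_small rK vol.
  by have := defect_bound fG weight t_gt0 c_gt0 cl dense; lia.
Qed.
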